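(* Let $\gamma_0$ be a simple closed curve in $\mathbb{R}^2$ with positive curvature. Let $\gamma$ be a smooth closed curve in $\mathbb{R}^3$ that is locally a graph over $\gamma_0$. If the torsion $\tau$ of $\gamma$ satisfies $\tau\ge 0$ everywhere (or $\tau\le 0$ everywhere), then $\tau\equiv 0$, and hence $\gamma$ lies in a plane.
   Context: A simple closed curve $\gamma_0$ in $\mathbb{R}^2$ (smooth, regular, without self-intersections) has positive curvature if, upon choosing its orientation suitably, its signed curvature is strictly positive everywhere; it may then be parametrized $2\pi$-periodically by the angle $\theta$ of its unit tangent vector $(\cos\theta,\sin\theta)$. That the closed curve $\gamma$ is locally a graph over $\gamma_0$ means that $\gamma$ projects down to $\gamma_0$ but may wrap around the cylinder over $\gamma_0$ more than once: there are an integer $k\ge 1$ and a smooth function $h:\mathbb{R}\to\mathbb{R}$, periodic with period $2\pi k$, such that $\gamma(\theta)=(\gamma_0(\theta);h(\theta))$. Torsion convention: for a curve parametrized by arc length with nonzero curvature $\kappa=|\gamma''|$, the Frenet frame satisfies $T'=\kappa N$, $N'=-\kappa T+\tau B$, $B'=-\tau N$; in an arbitrary regular parametrization, $\tau=\dfrac{(\gamma'\times\gamma'')\cdot\gamma'''}{|\gamma'\times\gamma''|^2}$. *)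

(* Defs.v *)
From Stdlib Require Import Reals.
From Coquelicot Require Import Coquelicot.
Open Scope R_scope.

Definition R2 : Type := (R * R)%type.
Definition R3 : Type := (R * R * R)%type.

Definition smooth (f : R -> R) : Prop := forall n t, ex_derive_n f n t.

Definition periodic {T : Type} (f : R -> T) (p : R) : Prop :=
  forall t, f (t + p) = f t.

Definition diffeomorphism (phi : R -> R) : Prop :=
  smooth phi /\
  exists psi, smooth psi /\ (forall t, psi (phi t) = t) /\
              (forall s, phi (psi s) = s).

Definition smooth2 (c : R -> R2) : Prop :=
  smooth (fun t => fst (c t)) /\ smooth (fun t => snd (c t)).

Definition derive2 (n : nat) (c : R -> R2) (t : R) : R2 :=
  (Derive_n (fun s => fst (c s)) n t, Derive_n (fun s => snd (c s)) n t).

Definition norm2 (v : R2) : R := sqrt (fst v ^ 2 + snd v ^ 2).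

Definition speed2 (c : R -> R2) (t : R) : R := norm2 (derive2 1 c t).

Definition simple_closed_with_period (c : R -> R2) (p : R) : Prop :=
  0 < p /\ smooth2 c /\ (forall t, derive2 1 c t <> (0, 0)) /\ periodic c p /\
  (forall s t, 0 <= s < p -> 0 <= t < p -> c s = c t -> s = t).

Definition simple_closed_curve (c : R -> R2) : Prop :=
  exists p, simple_closed_with_period c p.

Definition signed_curvature (c : R -> R2) (t : R) : R :=
  let v := derive2 1 c t in
  let a := derive2 2 c t in
  (fst v * snd a - snd v * fst a) / speed2 c t ^ 3.

(* The disjunction is the choice of orientation. *)
Definition positive_curvature (c : R -> R2) : Prop :=
  (forall t, 0 < signed_curvature c t) \/
  (forall t, 0 < signed_curvature (fun s => c (- s)) t).

(* [g] is the curve [c] parametrized, 2 pi-periodically, by the angle of its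
   unit tangent vector; [phi] is decreasing when the orientation of [c] has to
   be reversed to make the curvature positive. *)
Definition tangent_angle_parametrization (c g : R -> R2) : Prop :=
  simple_closed_with_period g (2 * PI) /\
  (exists phi, diffeomorphism phi /\ forall theta, g theta = c (phi theta)) /\
  (forall theta, derive2 1 g theta =
     (speed2 g theta * cos theta, speed2 g theta * sin theta)).

Definition smooth3 (c : R -> R3) : Prop :=
  smooth (fun t => fst (fst (c t))) /\ smooth (fun t => snd (fst (c t))) /\
  smooth (fun t => snd (c t)).

Definition smooth_closed_curve3 (c : R -> R3) : Prop :=
  smooth3 c /\ exists p, 0 < p /\ periodic c p.

Definition derive3 (n : nat) (c : R -> R3) (t : R) : R3 :=
  (Derive_n (fun s => fst (fst (c s))) n t,
   Derive_n (fun s => snd (fst (c s))) n t,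
   Derive_n (fun s => snd (c s)) n t).

Definition dot3 (u v : R3) : R :=
  let '(u1, u2, u3) := u in
  let '(v1, v2, v3) := v in
  u1 * v1 + u2 * v2 + u3 * v3.

Definition cross3 (u v : R3) : R3 :=
  let '(u1, u2, u3) := u in
  let '(v1, v2, v3) := v in
  (u2 * v3 - u3 * v2, u3 * v1 - u1 * v3, u1 * v2 - u2 * v1).

(* Sign convention B' = - tau N. *)
Definition torsion (c : R -> R3) (t : R) : R :=
  let b := cross3 (derive3 1 c t) (derive3 2 c t) in
  dot3 b (derive3 3 c t) / dot3 b b.

(* [gamma] projects to [gamma0], going round it [k] times. *)
Definition locally_graph_over (gamma : R -> R3) (gamma0 : R -> R2) : Prop :=
  exists (g : R -> R2) (k : nat) (h : R -> R),
    tangent_angle_parametrization gamma0 g /\ (1 <= k)%nat /\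
    smooth h /\ periodic h (2 * PI * INR k) /\
    forall theta, gamma theta = (g theta, h theta).

Definition lies_in_plane (c : R -> R3) : Prop :=
  exists (n : R3) (d : R), n <> (0, 0, 0) /\ forall t, dot3 n (c t) = d.

(* Main.v *)
Require Import Defs.
From Stdlib Require Import Reals.
From Coquelicot Require Import Coquelicot.
From Stdlib Require Import ZArith Lra Lia.
Open Scope R_scope.

(** Write [g' = s (cos, sin)] with [s > 0] for the plane curve parametrized by
    its tangent angle, and [h' = s u] for the height, so that the space curve has
    velocity [s V] with [V = (cos, sin, u)].  The determinant of [V, V', V''] is
    [u'' + u], hence the torsion is a positive multiple of [f := u'' + u], and a
    sign of the torsion is a sign of [f] ([torsion_of_scaled_velocity]).

    Let [p(theta) = (g(theta) - g(a)) . (sin theta, - cos theta)] be the support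
    function of the convex curve, seen from one of its own points [g(a)].  It
    satisfies [p'' + p = s]; it is nonnegative, because the curve lies on one
    side of each of its tangent lines, and positive at [a + PI]
    ([support_positive], [support_nonneg]).  Then
    [(p u' - p' u + h)' = p (u'' + u) - (p'' + p) u + s u = p f],
    which has a sign, while [p u' - p' u + h] has the period of [h]; hence
    [p f = 0] everywhere.  Evaluating at [a + PI], for every base point [a],
    gives [f = 0] ([torsion_factor_vanishes]).  The number of turns only enters
    through the existence of a common period.

    Finally [u'' + u = 0] means [u = A cos + B sin], so [h' = A g1' + B g2'] and
    [h - A g1 - B g2] is constant: this is the equation of a plane
    ([height_affine_of_harmonic]). *)

(** * Derivatives of functions on the line *)

Definition has_two_derivatives (f f1 f2 : R -> R) : Prop :=
  (forall t, is_derive f t (f1 t)) /\ (forall t, is_derive f1 t (f2 t)).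

Definition twice_derivable (f : R -> R) : Prop :=
  exists f1 f2, has_two_derivatives f f1 f2.

Lemma twice_derivable_ext (f f' : R -> R) :
  (forall t, f t = f' t) -> twice_derivable f -> twice_derivable f'.
Proof.
intros E (f1 & f2 & H1 & H2); exists f1, f2; split; [|exact H2].
intro t; apply is_derive_ext with f; auto.
Qed.

Lemma smooth_is_derive (f : R -> R) (n : nat) (t : R) :
  smooth f -> is_derive (Derive_n f n) t (Derive_n f (S n) t).
Proof. intro Hf; apply Derive_correct; exact (Hf (S n) t). Qed.

Lemma smooth_twice_derivable_Derive (f : R -> R) :
  smooth f -> twice_derivable (Derive f).
Proof.
intro Hf; exists (Derive_n f 2), (Derive_n f 3).
split; intro t; [exact (smooth_is_derive f 1 t Hf)|exact (smooth_is_derive f 2 t Hf)].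
Qed.

Lemma has_two_derivatives_cos :
  has_two_derivatives cos (fun t => - sin t) (fun t => - cos t).
Proof. split; intro t; auto_derive; trivial; ring. Qed.

Lemma has_two_derivatives_sin :
  has_two_derivatives sin cos (fun t => - sin t).
Proof. split; intro t; auto_derive; trivial; ring. Qed.

Lemma has_two_derivatives_mult (f f1 f2 g g1 g2 : R -> R) :
  has_two_derivatives f f1 f2 -> has_two_derivatives g g1 g2 ->
  has_two_derivatives (fun t => f t * g t)
    (fun t => f1 t * g t + f t * g1 t)
    (fun t => f2 t * g t + 2 * f1 t * g1 t + f t * g2 t).
Proof.
assert (P : forall (a b : R -> R) t a' b', is_derive a t a' -> is_derive b t b' ->
  is_derive (fun x => a x * b x) t (a' * b t + a t * b')).
{ intros a b t a' b' Ha Hb.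
  exact (is_derive_mult a b t a' b' Ha Hb Rmult_comm). }
intros [F1 F2] [G1 G2]; split; intro t; [now apply P|].
replace (f2 t * g t + 2 * f1 t * g1 t + f t * g2 t) with
  ((f2 t * g t + f1 t * g1 t) + (f1 t * g1 t + f t * g2 t)) by ring.
apply (is_derive_plus (fun t => f1 t * g t) (fun t => f t * g1 t)); now apply P.
Qed.

Lemma twice_derivable_mult (f g : R -> R) :
  twice_derivable f -> twice_derivable g -> twice_derivable (fun t => f t * g t).
Proof.
intros (f1 & f2 & F) (g1 & g2 & G); do 2 eexists.
exact (has_two_derivatives_mult _ _ _ _ _ _ F G).
Qed.

Lemma twice_derivable_plus (f g : R -> R) :
  twice_derivable f -> twice_derivable g -> twice_derivable (fun t => f t + g t).
Proof.
intros (f1 & f2 & F1 & F2) (g1 & g2 & G1 & G2).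
exists (fun t => f1 t + g1 t), (fun t => f2 t + g2 t).
split; intro t; [exact (is_derive_plus f g t _ _ (F1 t) (G1 t))|].
exact (is_derive_plus f1 g1 t _ _ (F2 t) (G2 t)).
Qed.

Lemma twice_derivable_inv (f : R -> R) :
  (forall t, f t <> 0) -> twice_derivable f -> twice_derivable (fun t => / f t).
Proof.
intros Hf (f1 & f2 & F1 & F2).
exists (fun t => - f1 t / f t ^ 2),
  (fun t => - f2 t / f t ^ 2 + 2 * f1 t ^ 2 / f t ^ 3).
split; intro t; [exact (is_derive_inv f t _ (F1 t) (Hf t))|].
auto_derive.
- repeat split; [now exists (f2 t)|now exists (f1 t)|].
  rewrite Rmult_1_r; apply Rmult_integral_contrapositive_currified; apply Hf.
- replace (Derive (fun x => f1 x) t) with (f2 t) by (symmetry; apply is_derive_unique, F2).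
  replace (Derive (fun x => f x) t) with (f1 t) by (symmetry; apply is_derive_unique, F1).
  field; apply Hf.
Qed.

Lemma increasing_of_positive_derivative (F D : R -> R) (a b : R) :
  (forall t, is_derive F t (D t)) -> a < b -> (forall t, a < t < b -> 0 < D t) ->
  F a < F b.
Proof.
intros HF Hab HD.
destruct (MVT_cor2 F D a b Hab) as (c & E & Hc).
{ intros c _; apply is_derive_Reals, HF. }
enough (0 < D c * (b - a)) by lra.
apply Rmult_lt_0_compat; [now apply HD|lra].
Qed.

Lemma nondecreasing_of_nonneg_derivative (F D : R -> R) (a b : R) :
  (forall t, is_derive F t (D t)) -> (forall t, 0 <= D t) -> a <= b -> F a <= F b.
Proof.
intros HF HD [Hab|<-]; [|lra].
destruct (MVT_cor2 F D a b Hab) as (c & E & Hc).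
{ intros c _; apply is_derive_Reals, HF. }
enough (0 <= D c * (b - a)) by lra.
apply Rmult_le_pos; [apply HD|lra].
Qed.

Lemma constant_of_zero_derivative (F : R -> R) :
  (forall t, is_derive F t 0) -> forall s t, F s = F t.
Proof.
intros HF.
assert (L : forall s t, s < t -> F s = F t).
{ intros s t Hst; apply (eq_is_derive F s t); [|exact Hst].
  intros x _; apply HF. }
intros s t; destruct (Rtotal_order s t) as [H|[->|H]]; auto.
symmetry; auto.
Qed.

(** * Periodic functions *)

Lemma periodic_multiple (f : R -> R) (p : R) (k : nat) :
  periodic f p -> periodic f (p * INR k).
Proof.
intros Hf t; induction k as [|k IH].
- f_equal; simpl; ring.
- rewrite <- IH, <- (Hf (t + p * INR k)); f_equal; rewrite S_INR; ring.
Qed.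

Lemma periodic_derivative (f f1 : R -> R) (p : R) :
  (forall t, is_derive f t (f1 t)) -> periodic f p -> periodic f1 p.
Proof.
intros Hf Hp t.
rewrite <- (is_derive_unique f t _ (Hf t)).
symmetry; apply is_derive_unique.
apply is_derive_ext with (fun x => f (x + p)); [exact Hp|].
replace (f1 (t + p)) with (scal 1 (f1 (t + p))) by apply (scal_one (f1 (t + p))).
apply (is_derive_comp f (fun x => x + p)); [apply Hf|].
auto_derive; trivial.
Qed.

(** A function that returns to its value after a period and never decreases in
    between is locally constant. *)
Lemma periodic_monotone_derivative_zero (F D : R -> R) (p : R) :
  0 < p -> periodic F p -> (forall t, is_derive F t (D t)) ->
  (forall t, 0 <= D t) -> forall t, D t = 0.
Proof.
intros Hp HF HD Hpos t.
rewrite <- (is_derive_unique F t _ (HD t)).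
apply is_derive_unique, is_derive_ext_loc with (fun _ => F t);
  [|apply (is_derive_const (F t) t)].
assert (Hp2 : 0 < p / 2) by lra.
exists (mkposreal _ Hp2); intros y Hy.
apply Rabs_def2 in Hy; unfold minus, plus, opp in Hy; simpl in Hy.
pose proof (nondecreasing_of_nonneg_derivative F D) as M.
(* Both points lie in a window of one period, at whose ends [F] agrees. *)
pose proof (HF (t - p / 2)) as E.
pose proof (M (t - p / 2) t HD Hpos).
pose proof (M t (t - p / 2 + p) HD Hpos).
pose proof (M (t - p / 2) y HD Hpos).
pose proof (M y (t - p / 2 + p) HD Hpos).
lra.
Qed.

(** * The support function of a convex curve *)

(** Component of the chord from [g a] to [g x] along the outward normal at
    tangent angle [t]; the support function seen from [g a] is its restriction
    to [x = t]. *)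
Definition normal_chord (g1 g2 : R -> R) (a t x : R) : R :=
  (g1 x - g1 a) * sin t - (g2 x - g2 a) * cos t.

Definition tangent_chord (g1 g2 : R -> R) (a t x : R) : R :=
  (g1 x - g1 a) * cos t + (g2 x - g2 a) * sin t.

Lemma is_derive_normal_chord (g1 g2 s : R -> R) (a t x : R) :
  is_derive g1 x (s x * cos x) -> is_derive g2 x (s x * sin x) ->
  is_derive (normal_chord g1 g2 a t) x (s x * sin (t - x)).
Proof.
intros H1 H2; unfold normal_chord; auto_derive.
- repeat split; eexists; eassumption.
- replace (Derive (fun y => g1 y) x) with (s x * cos x)
    by (symmetry; now apply is_derive_unique).
  replace (Derive (fun y => g2 y) x) with (s x * sin x)
    by (symmetry; now apply is_derive_unique).
  rewrite sin_minus; ring.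
Qed.

(** At the point of tangent angle [x], the outward height above the line through
    [g a] in direction [t] has derivative [s x * sin (t - x)].  It starts from [0]
    at [a] and increases up to [t] if that arc turns by at most [PI]; otherwise
    the arc from [t] to [a + 2 PI] turns by less than [PI], and the height
    decreases along it to [0], because the curve closes up. *)
Lemma support_positive (g1 g2 s : R -> R) (a t : R) :
  (forall x, is_derive g1 x (s x * cos x)) ->
  (forall x, is_derive g2 x (s x * sin x)) ->
  periodic g1 (2 * PI) -> periodic g2 (2 * PI) -> (forall x, 0 < s x) ->
  a < t < a + 2 * PI -> 0 < normal_chord g1 g2 a t t.
Proof.
intros H1 H2 P1 P2 Hs Ht.
pose proof (fun x => is_derive_normal_chord g1 g2 s a t x (H1 x) (H2 x)) as HD.
destruct (Rle_lt_dec t (a + PI)) as [L|L].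
- replace 0 with (normal_chord g1 g2 a t a) by (unfold normal_chord; ring).
  apply (increasing_of_positive_derivative _ _ a t HD); [lra|].
  intros x Hx; apply Rmult_lt_0_compat; [apply Hs|apply sin_gt_0; lra].
- replace 0 with (normal_chord g1 g2 a t (a + 2 * PI))
    by (unfold normal_chord; rewrite P1, P2; ring).
  apply Ropp_lt_cancel.
  apply (increasing_of_positive_derivative
    (fun x => - normal_chord g1 g2 a t x) (fun x => - (s x * sin (t - x)))); [|lra|].
  + intro x; exact (is_derive_opp _ _ _ (HD x)).
  + intros x Hx; replace (t - x) with (- (x - t)) by ring; rewrite sin_neg.
    replace (- (s x * - sin (x - t))) with (s x * sin (x - t)) by ring.
    apply Rmult_lt_0_compat; [apply Hs|apply sin_gt_0; lra].
Qed.

Lemma support_nonneg (g1 g2 s : R -> R) (a t : R) :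
  (forall x, is_derive g1 x (s x * cos x)) ->
  (forall x, is_derive g2 x (s x * sin x)) ->
  periodic g1 (2 * PI) -> periodic g2 (2 * PI) -> (forall x, 0 < s x) ->
  0 <= normal_chord g1 g2 a t t.
Proof.
intros H1 H2 P1 P2 Hs.
pose proof PI_RGT_0 as Hpi.
(* The base point may be moved by whole turns, to just before [t]. *)
set (m := Int_part ((t - a) / (2 * PI))).
set (b := a + 2 * PI * IZR m).
assert (Pz : forall f : R -> R, periodic f (2 * PI) -> f b = f a).
{ intros f Hf; unfold b; destruct (Z.le_gt_cases 0 m) as [Hm|Hm].
  - rewrite <- (Z2Nat.id m Hm), <- INR_IZR_INZ.
    exact (periodic_multiple f _ (Z.to_nat m) Hf a).
  - rewrite <- (periodic_multiple f _ (Z.to_nat (- m)) Hf (a + 2 * PI * IZR m)).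
    rewrite INR_IZR_INZ, Z2Nat.id, opp_IZR by lia.
    f_equal; ring. }
replace (normal_chord g1 g2 a t t) with (normal_chord g1 g2 b t t)
  by (unfold normal_chord; now rewrite (Pz g1 P1), (Pz g2 P2)).
destruct (base_Int_part ((t - a) / (2 * PI))) as [B1 B2]; fold m in B1, B2.
assert (E : t - a = 2 * PI * ((t - a) / (2 * PI))) by (field; lra).
assert (B3 : b <= t).
{ pose proof (Rmult_le_compat_l (2 * PI) _ _ ltac:(lra) B1); unfold b; lra. }
assert (B4 : t < b + 2 * PI).
{ pose proof (Rmult_lt_compat_l (2 * PI) ((t - a) / (2 * PI)) (IZR m + 1)
    ltac:(lra) ltac:(lra)); unfold b; lra. }
destruct B3 as [B3| ->]; [|unfold normal_chord; lra].
apply Rlt_le, (support_positive g1 g2 s); auto.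
Qed.

(** * The torsion of a curve over a convex curve *)

(** With [P] and [Q] the normal and tangential components of [g - g(a)], one has
    [P' = Q] and [Q' = s - P], so that [P u' - Q u + h] is the periodic function
    with derivative [P (u'' + u)].  Putting the base point half a turn before [x]
    makes [P x] positive. *)
Lemma torsion_factor_vanishes (g1 g2 s h u u1 u2 : R -> R) (k : nat) :
  (forall x, is_derive g1 x (s x * cos x)) ->
  (forall x, is_derive g2 x (s x * sin x)) ->
  periodic g1 (2 * PI) -> periodic g2 (2 * PI) -> (forall x, 0 < s x) ->
  (forall x, is_derive h x (s x * u x)) -> has_two_derivatives u u1 u2 ->
  (1 <= k)%nat -> periodic h (2 * PI * INR k) -> periodic u (2 * PI * INR k) ->
  (forall x, 0 <= u2 x + u x) -> forall x, u2 x + u x = 0.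
Proof.
intros H1 H2 P1 P2 Hs Hh [Hu Hu1] Hk Qh Qu Hf x.
set (p := 2 * PI * INR k) in *.
assert (Hp : 0 < p).
{ pose proof PI_RGT_0; apply Rmult_lt_0_compat; [lra|now apply lt_0_INR]. }
assert (Q1 : periodic g1 p) by now apply periodic_multiple.
assert (Q2 : periodic g2 p) by now apply periodic_multiple.
assert (Qs : periodic sin p)
  by (apply periodic_multiple; intro t; rewrite sin_plus, sin_2PI, cos_2PI; ring).
assert (Qc : periodic cos p)
  by (apply periodic_multiple; intro t; rewrite cos_plus, sin_2PI, cos_2PI; ring).
set (a := x - PI).
set (F := fun t => normal_chord g1 g2 a t t * u1 t - tangent_chord g1 g2 a t t * u t + h t).
assert (Z : forall t, normal_chord g1 g2 a t t * (u2 t + u t) = 0).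
{ apply (periodic_monotone_derivative_zero F _ p Hp).
  - intro t; unfold F, normal_chord, tangent_chord.
    now rewrite Q1, Q2, Qs, Qc, Qh, Qu, (periodic_derivative u u1 p Hu Qu).
  - intro t; unfold F, normal_chord, tangent_chord; auto_derive.
    + repeat split; first [exact (ex_intro _ _ (H1 t))|exact (ex_intro _ _ (H2 t))|exact (ex_intro _ _ (Hu t))|exact (ex_intro _ _ (Hu1 t))|exact (ex_intro _ _ (Hh t))].
    + replace (Derive (fun y => g1 y) t) with (s t * cos t) by (symmetry; apply is_derive_unique, H1).
      replace (Derive (fun y => g2 y) t) with (s t * sin t) by (symmetry; apply is_derive_unique, H2).
      replace (Derive (fun y => u y) t) with (u1 t) by (symmetry; apply is_derive_unique, Hu).
      replace (Derive (fun y => u1 y) t) with (u2 t) by (symmetry; apply is_derive_unique, Hu1).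
      replace (Derive (fun y => h y) t) with (s t * u t) by (symmetry; apply is_derive_unique, Hh).
      pose proof (sin2_cos2 t) as T; unfold Rsqr in T.
      replace (s t * u t) with (s t * u t * (sin t * sin t + cos t * cos t)) at 1
        by (rewrite T; ring).
      ring.
  - intro t; apply Rmult_le_pos; [|apply Hf].
    now apply support_nonneg with s. }
destruct (Rmult_integral _ _ (Z x)) as [E|E]; [exfalso|exact E].
assert (0 < normal_chord g1 g2 a x x); [|lra].
pose proof PI_RGT_0; apply support_positive with s; auto; unfold a; lra.
Qed.

Lemma derivatives_of_scaled_velocity (x s s1 s2 v v1 v2 : R -> R) (t : R) :
  (forall y, is_derive x y (s y * v y)) ->
  has_two_derivatives s s1 s2 -> has_two_derivatives v v1 v2 ->
  Derive_n x 1 t = s t * v t /\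
  Derive_n x 2 t = s1 t * v t + s t * v1 t /\
  Derive_n x 3 t = s2 t * v t + 2 * s1 t * v1 t + s t * v2 t.
Proof.
intros Hx Hs Hv.
destruct (has_two_derivatives_mult _ _ _ _ _ _ Hs Hv) as [M1 M2].
assert (E1 : forall y, Derive_n x 1 y = s y * v y)
  by (intro y; apply is_derive_unique, Hx).
assert (E2 : forall y, Derive_n x 2 y = s1 y * v y + s y * v1 y).
{ intro y; change (Derive (Derive_n x 1) y = s1 y * v y + s y * v1 y).
  rewrite (Derive_ext _ _ y E1); apply is_derive_unique, M1. }
repeat split; [apply E1|apply E2|].
change (Derive (Derive_n x 2) t = s2 t * v t + 2 * s1 t * v1 t + s t * v2 t).
rewrite (Derive_ext _ _ t E2); apply is_derive_unique, M2.
Qed.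

(** The triple product of the derivatives of a curve with velocity [s V] is
    [s ^ 3] times the determinant of [V, V', V''], which is [u'' + u] for
    [V = (cos, sin, u)].  The binormal direction is nonzero because its third
    component is [s ^ 2]. *)
Lemma torsion_of_scaled_velocity (gamma : R -> R3) (s s1 s2 u u1 u2 : R -> R) (t : R) :
  (forall x, is_derive (fun y => fst (fst (gamma y))) x (s x * cos x)) ->
  (forall x, is_derive (fun y => snd (fst (gamma y))) x (s x * sin x)) ->
  (forall x, is_derive (fun y => snd (gamma y)) x (s x * u x)) ->
  has_two_derivatives s s1 s2 -> has_two_derivatives u u1 u2 -> 0 < s t ->
  exists c, 0 < c /\ torsion gamma t = c * (u2 t + u t).
Proof.
intros H1 H2 H3 Ss Su Hs.
destruct (derivatives_of_scaled_velocity _ _ _ _ _ _ _ t H1 Ss has_two_derivatives_cos)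
  as (A1 & A2 & A3).
destruct (derivatives_of_scaled_velocity _ _ _ _ _ _ _ t H2 Ss has_two_derivatives_sin)
  as (B1 & B2 & B3).
destruct (derivatives_of_scaled_velocity _ _ _ _ _ _ _ t H3 Ss Su) as (C1 & C2 & C3).
pose proof (f_equal2 pair (f_equal2 pair A1 B1) C1 : derive3 1 gamma t = _) as E1.
pose proof (f_equal2 pair (f_equal2 pair A2 B2) C2 : derive3 2 gamma t = _) as E2.
pose proof (f_equal2 pair (f_equal2 pair A3 B3) C3 : derive3 3 gamma t = _) as E3.
unfold torsion; rewrite E1, E2, E3.
set (b := cross3 _ _); pose proof (sin2_cos2 t) as T; unfold Rsqr in T.
assert (Hb : 0 < dot3 b b).
{ unfold b, cross3, dot3; set (b1 := _ - _); set (b2 := _ - _); set (b3 := _ - _).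
  assert (E : b3 = s t * s t * (sin t * sin t + cos t * cos t)) by (unfold b3; ring).
  rewrite T, Rmult_1_r in E.
  pose proof (Rle_0_sqr b1); pose proof (Rle_0_sqr b2); unfold Rsqr in *.
  assert (0 < b3) by (rewrite E; now apply Rmult_lt_0_compat).
  assert (0 < b3 * b3) by (now apply Rmult_lt_0_compat).
  lra. }
exists (s t ^ 3 / dot3 b b); split.
- apply Rdiv_lt_0_compat; [now apply pow_lt|exact Hb].
- enough (E : dot3 b (s2 t * cos t + 2 * s1 t * - sin t + s t * - cos t,
      s2 t * sin t + 2 * s1 t * cos t + s t * - sin t,
      s2 t * u t + 2 * s1 t * u1 t + s t * u2 t)
    = s t ^ 3 * (u2 t + u t)).
  { rewrite E; field; lra. }
  transitivity (s t ^ 3 * (u2 t + u t) * (sin t * sin t + cos t * cos t));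
    [unfold b, cross3, dot3; ring|rewrite T; ring].
Qed.

(** [A] and [B] are the first integrals [u cos - u' sin] and [u sin + u' cos] of
    the oscillator equation [u'' + u = 0]. *)
Lemma height_affine_of_harmonic (g1 g2 s h u u1 u2 : R -> R) :
  (forall x, is_derive g1 x (s x * cos x)) ->
  (forall x, is_derive g2 x (s x * sin x)) ->
  (forall x, is_derive h x (s x * u x)) -> has_two_derivatives u u1 u2 ->
  (forall x, u2 x + u x = 0) ->
  exists A B d, forall x, h x - A * g1 x - B * g2 x = d.
Proof.
intros H1 H2 Hh [Hu Hu1] Hf.
set (A := fun x => u x * cos x - u1 x * sin x).
set (B := fun x => u x * sin x + u1 x * cos x).
assert (cA : forall x, A x = A 0).
{ intro x; apply constant_of_zero_derivative; intro t; unfold A; auto_derive.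
  - repeat split; first [exact (ex_intro _ _ (Hu t))|exact (ex_intro _ _ (Hu1 t))].
  - replace (Derive (fun y => u y) t) with (u1 t) by (symmetry; apply is_derive_unique, Hu).
    replace (Derive (fun y => u1 y) t) with (u2 t) by (symmetry; apply is_derive_unique, Hu1).
    replace (u2 t) with (- u t) by (specialize (Hf t); lra); ring. }
assert (cB : forall x, B x = B 0).
{ intro x; apply constant_of_zero_derivative; intro t; unfold B; auto_derive.
  - repeat split; first [exact (ex_intro _ _ (Hu t))|exact (ex_intro _ _ (Hu1 t))].
  - replace (Derive (fun y => u y) t) with (u1 t) by (symmetry; apply is_derive_unique, Hu).
    replace (Derive (fun y => u1 y) t) with (u2 t) by (symmetry; apply is_derive_unique, Hu1).
    replace (u2 t) with (- u t) by (specialize (Hf t); lra); ring. }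
exists (A 0), (B 0), (h 0 - A 0 * g1 0 - B 0 * g2 0); intro x.
apply (constant_of_zero_derivative (fun x => h x - A 0 * g1 x - B 0 * g2 x)).
intro t; auto_derive.
- repeat split; first [exact (ex_intro _ _ (H1 t))|exact (ex_intro _ _ (H2 t))|exact (ex_intro _ _ (Hh t))].
- replace (Derive (fun y => g1 y) t) with (s t * cos t) by (symmetry; apply is_derive_unique, H1).
  replace (Derive (fun y => g2 y) t) with (s t * sin t) by (symmetry; apply is_derive_unique, H2).
  replace (Derive (fun y => h y) t) with (s t * u t) by (symmetry; apply is_derive_unique, Hh).
  rewrite <- (cA t), <- (cB t); unfold A, B.
  pose proof (sin2_cos2 t) as T; unfold Rsqr in T.
  replace (s t * u t) with (s t * u t * (sin t * sin t + cos t * cos t)) at 1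
    by (rewrite T; ring).
  ring.
Qed.

(** * Curves over a curve parametrized by its tangent angle *)

Lemma speed2_positive (c : R -> R2) (t : R) :
  derive2 1 c t <> (0, 0) -> 0 < speed2 c t.
Proof.
unfold speed2, norm2; destruct (derive2 1 c t) as [x y]; simpl; intro H.
apply sqrt_lt_R0.
destruct (Req_dec x 0) as [->|Hx]; [destruct (Req_dec y 0) as [->|Hy]; [now elim H|]|].
- pose proof (Rsqr_pos_lt y Hy); unfold Rsqr in *; lra.
- pose proof (Rsqr_pos_lt x Hx); pose proof (Rle_0_sqr y); unfold Rsqr in *; lra.
Qed.

(** The speed is the component of the velocity along the unit tangent, which
    exhibits it as a differentiable function. *)
Lemma tangent_angle_parametrization_data (c g : R -> R2) :
  tangent_angle_parametrization c g ->
  (forall x, is_derive (fun y => fst (g y)) x (speed2 g x * cos x)) /\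
  (forall x, is_derive (fun y => snd (g y)) x (speed2 g x * sin x)) /\
  periodic (fun y => fst (g y)) (2 * PI) /\ periodic (fun y => snd (g y)) (2 * PI) /\
  (forall x, 0 < speed2 g x) /\ periodic (speed2 g) (2 * PI) /\
  twice_derivable (speed2 g).
Proof.
intros ((_ & [S1 S2] & Hreg & Hper & _) & _ & Hang).
set (g1 := fun y => fst (g y)) in *; set (g2 := fun y => snd (g y)) in *.
assert (E1 : forall x, Derive g1 x = speed2 g x * cos x)
  by (intro x; exact (f_equal fst (Hang x))).
assert (E2 : forall x, Derive g2 x = speed2 g x * sin x)
  by (intro x; exact (f_equal snd (Hang x))).
assert (D1 : forall x, is_derive g1 x (Derive g1 x))
  by (intro x; exact (smooth_is_derive g1 0 x S1)).
assert (D2 : forall x, is_derive g2 x (Derive g2 x))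
  by (intro x; exact (smooth_is_derive g2 0 x S2)).
assert (P1 : periodic g1 (2 * PI)) by (intro x; unfold g1; now rewrite Hper).
assert (P2 : periodic g2 (2 * PI)) by (intro x; unfold g2; now rewrite Hper).
split; [|split; [|split; [exact P1|split; [exact P2|split; [|split]]]]].
- intro x; rewrite <- E1; apply D1.
- intro x; rewrite <- E2; apply D2.
- intro x; apply speed2_positive, Hreg.
- intro x; unfold speed2, derive2.
  change (norm2 (Derive g1 (x + 2 * PI), Derive g2 (x + 2 * PI))
          = norm2 (Derive g1 x, Derive g2 x)).
  now rewrite (periodic_derivative g1 _ _ D1 P1), (periodic_derivative g2 _ _ D2 P2).
- apply twice_derivable_ext with (fun x => Derive g1 x * cos x + Derive g2 x * sin x).
  + intro x; rewrite E1, E2.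
    pose proof (sin2_cos2 x) as T; unfold Rsqr in T.
    transitivity (speed2 g x * (sin x * sin x + cos x * cos x));
      [ring|rewrite T; ring].
  + apply twice_derivable_plus; apply twice_derivable_mult.
    * exact (smooth_twice_derivable_Derive g1 S1).
    * do 2 eexists; exact has_two_derivatives_cos.
    * exact (smooth_twice_derivable_Derive g2 S2).
    * do 2 eexists; exact has_two_derivatives_sin.
Qed.

Theorem theorem4 (gamma0 : R -> R2) (gamma : R -> R3)
    (gamma0_simple : simple_closed_curve gamma0)
    (gamma0_convex : positive_curvature gamma0)
    (gamma_closed : smooth_closed_curve3 gamma)
    (gamma_graph : locally_graph_over gamma gamma0)
    (torsion_sign : (forall theta, 0 <= torsion gamma theta) \/
                    (forall theta, torsion gamma theta <= 0)) :
  (forall theta, torsion gamma theta = 0) /\ lies_in_plane gamma.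
Proof.
destruct gamma_graph as (g & k & h & Hg & Hk & Sh & Ph & Hgamma).
destruct (tangent_angle_parametrization_data _ _ Hg)
  as (H1 & H2 & P1 & P2 & Hs & Ps & Ds).
set (s := speed2 g) in *.
set (g1 := fun y => fst (g y)) in *; set (g2 := fun y => snd (g y)) in *.
set (u := fun x => Derive h x * / s x).
assert (Hs0 : forall x, s x <> 0) by (intro x; specialize (Hs x); lra).
assert (Dh : forall x, is_derive h x (Derive h x))
  by (intro x; exact (smooth_is_derive h 0 x Sh)).
assert (Hh : forall x, is_derive h x (s x * u x)).
{ intro x; replace (s x * u x) with (Derive h x) by (unfold u; field; apply Hs0).
  apply Dh. }
assert (Du : twice_derivable u).
{ apply twice_derivable_mult; [now apply smooth_twice_derivable_Derive|].
  now apply twice_derivable_inv. }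
destruct Ds as (s1 & s2 & Ds); destruct Du as (u1 & u2 & Du).
assert (Tor : forall t, exists c, 0 < c /\ torsion gamma t = c * (u2 t + u t)).
{ intro t; apply (torsion_of_scaled_velocity gamma s s1 s2 u u1 u2 t); auto; intro x.
  - apply is_derive_ext with g1; [intro y; now rewrite Hgamma|apply H1].
  - apply is_derive_ext with g2; [intro y; now rewrite Hgamma|apply H2].
  - apply is_derive_ext with h; [intro y; now rewrite Hgamma|apply Hh]. }
set (p := 2 * PI * INR k) in *.
assert (Pu : periodic u p).
{ intro x; unfold u.
  now rewrite (periodic_derivative h _ p Dh Ph), (periodic_multiple s _ k Ps). }
assert (F0 : forall x, u2 x + u x = 0).
{ destruct torsion_sign as [Hsgn|Hsgn].
  - apply (torsion_factor_vanishes g1 g2 s h u u1 u2 k); auto.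
    intro x; destruct (Tor x) as (c & Hc & E).
    apply Rmult_le_reg_l with c; [exact Hc|].
    rewrite Rmult_0_r, <- E; apply Hsgn.
  - (* Reflecting the curve in the horizontal plane reverses the torsion. *)
    intro x.
    enough (- u2 x + - u x = 0) by lra; revert x.
    apply (torsion_factor_vanishes g1 g2 s (fun x => - h x) (fun x => - u x)
      (fun x => - u1 x) (fun x => - u2 x) k); auto.
    + intro x; replace (s x * - u x) with (- (s x * u x)) by ring.
      exact (is_derive_opp h x _ (Hh x)).
    + destruct Du as [U1 U2]; split; intro x;
        [exact (is_derive_opp u x _ (U1 x))|exact (is_derive_opp u1 x _ (U2 x))].
    + intro x; now rewrite Ph.
    + intro x; now rewrite Pu.
    + intro x; destruct (Tor x) as (c & Hc & E).
      enough (u2 x + u x <= 0) by lra.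
      apply Rmult_le_reg_l with c; [exact Hc|].
      rewrite Rmult_0_r, <- E; apply Hsgn. }
split.
- intro t; destruct (Tor t) as (c & _ & ->); rewrite F0; ring.
- destruct (height_affine_of_harmonic g1 g2 s h u u1 u2 H1 H2 Hh Du F0)
    as (A & B & d & Hd).
  exists (- A, - B, 1), d; split; [intro E; injection E; intros; lra|].
  intro t; rewrite Hgamma; rewrite <- (Hd t); unfold g1, g2, dot3.
  destruct (g t) as [x y]; simpl; ring.
Qed.
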